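(* Let $(X,d)$ be a Ptolemaic metric space. Suppose a zero-sum coefficient vector has exactly two positive coefficients and $r\ge 2$ negative coefficients. Let $1\le q\le\log_2 3$ and $\kappa_q=\frac{2^{q+1}-3}{3}$. If \[ \kappa_q\le\frac1{r-1}, \] then its $q$-negative-type inequality holds.
   Context: A metric is Ptolemaic if $d(x,y)d(z,w)\le d(x,z)d(y,w)+d(x,w)d(y,z)$ for all points $x,y,z,w$. A zero-sum coefficient vector is a finitely supported real vector $c=(c_x)_{x\in X}$ with $\sum_x c_x=0$; its $q$-negative-type inequality is $\sum_{x,y}c_xc_y\,d(x,y)^q\le 0$. *)

(* Defs.v *)
From HB Require Import structures.
From mathcomp Require Import all_boot all_order all_algebra finmap.
From mathcomp Require Import all_classical all_reals all_analysis.

Set Implicit Arguments.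
Unset Strict Implicit.
Unset Printing Implicit Defensive.

Import Order.TTheory GRing.Theory Num.Theory.

Local Open Scope fset_scope.
Local Open Scope ring_scope.

Definition ptolemaic (R : realType) (X : metricType R) : Prop :=
  forall x y z w : X,
    mdist x y * mdist z w <= mdist x z * mdist y w + mdist x w * mdist y z.

Definition zero_sum (R : realType) (X : choiceType)
    (c : {fsfun X -> R with 0}) : Prop :=
  \sum_(x <- finsupp c) c x = 0.

Definition pos_supp (R : realType) (X : choiceType)
    (c : {fsfun X -> R with 0}) : {fset X} :=
  [fset x in finsupp c | 0 < c x].

Definition neg_supp (R : realType) (X : choiceType)
    (c : {fsfun X -> R with 0}) : {fset X} :=
  [fset x in finsupp c | c x < 0].

Definition negative_type_ineq (R : realType) (X : metricType R) (q : R)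
    (c : {fsfun X -> R with 0}) : Prop :=
  \sum_(x <- finsupp c) \sum_(y <- finsupp c)
    c x * c y * (mdist x y `^ q) <= 0.

Definition log2 (R : realType) (x : R) : R := ln x / ln 2.

Definition kappa (R : realType) (q : R) : R := (2 `^ (q + 1) - 3) / 3.

(* Main.v *)
(* Write delta = d^(q/2) and k = 2^(q-1) - 1, which lies in [0, 1/2].  The
   inequality (u+v)^q <= u^q + v^q + 2 k (uv)^(q/2) turns both the triangle and
   the Ptolemy inequality for d into upper bounds for delta^2 that have the form
   of a law of cosines with cosine -k.  In particular every delta-triangle is
   Euclidean with angles at most 120 degrees.

   Let x, y be the positive points, w = delta(x, y), and let T_i be the Euclidean
   triangle with sides w, delta(x, z_i), delta(y, z_i), attached to the negative
   point z_i.  For two negative points the three angle sums of T_i and T_j add up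
   to 360 degrees, so at some vertex the sum s of the two angles satisfies
   cos s <= -1/2.  The bound for delta(z_i, z_j)^2 coming from this vertex is the
   triangle inequality through x or y, or the Ptolemy inequality for the third
   vertex.  It says that w^2 delta(z_i, z_j)^2 exceeds the polarization of the
   Heron form of w^2, delta(x, z)^2, delta(y, z)^2 by at most
   2 kappa t_i t_j, where t_i is twice the area of T_i and
   kappa = (4 k + 1) / 3 = kappa_q.  After summation the total error is
   controlled by Cauchy-Schwarz exactly when kappa (r - 1) <= 1, and what remains
   is minus a perfect square. *)
Require Import Defs.
From HB Require Import structures.
From mathcomp Require Import all_boot all_order all_algebra finmap.
From mathcomp Require Import all_classical all_reals all_analysis.
From mathcomp Require Import ring lra.

Set Implicit Arguments.
Unset Strict Implicit.
Unset Printing Implicit Defensive.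

Import Order.TTheory GRing.Theory Num.Theory.

Local Open Scope fset_scope.
Local Open Scope ring_scope.

(** * Angles as arguments of complex numbers *)

(** Here and below [f + i t] has modulus [L], so [f / L] is a cosine and [t / L] a sine. *)
Lemma sqr_le_half (R : realFieldType) (f t L : R) :
  f ^+ 2 + t ^+ 2 = L ^+ 2 -> 0 <= L -> - (L / 2) <= f -> f <= 0 ->
  3 / 4 * L ^+ 2 <= t ^+ 2.
Proof. by move=> e L0 fL f0; nra. Qed.

Lemma ler_mul_sqr (R : realFieldType) (a b c : R) :
  0 <= b -> 0 <= c -> a ^+ 2 <= b ^+ 2 * c ^+ 2 -> a <= b * c.
Proof.
move=> b0 c0; rewrite -exprMn => h.
have [a0|a0] := leP 0 a; first by rewrite -(@ler_pXn2r _ 2) ?nnegrE ?mulr_ge0.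
by rewrite (le_trans (ltW a0)) ?mulr_ge0.
Qed.

(** Both squared sines are at least 3/4. For a non-acute angle this is [sqr_le_half]; if the second
    angle is acute, [im] makes its sine at least the first one. The product of the cosines is at
    most 1/4. *)
Lemma arg_add_neg (R : realFieldType) (f t L f' t' L' : R) :
  f ^+ 2 + t ^+ 2 = L ^+ 2 -> f' ^+ 2 + t' ^+ 2 = L' ^+ 2 ->
  0 <= L -> 0 <= L' -> 0 < t -> 0 < t' ->
  - (L / 2) <= f -> f < 0 -> - (L' / 2) <= f' -> f * t' + f' * t <= 0 ->
  f * f' - t * t' <= - (L * L' / 2).
Proof.
move=> e e' L0 L'0 t0 t'0 fL f0 f'L' im.
have ht := sqr_le_half e L0 fL (ltW f0).
have [f'0|f'0] := leP f' 0.
  have ht' := sqr_le_half e' L'0 f'L' f'0.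
  have h1 : L * L' * (3 / 4) <= t * t'.
    apply: ler_mul_sqr; [exact: ltW|exact: ltW|].
    have h34 : 0 <= 3 / 4 :> R by lra.
    have := ler_pM (mulr_ge0 h34 (sqr_ge0 L)) (mulr_ge0 h34 (sqr_ge0 L')) ht ht'.
    rewrite !exprMn; lra.
  have : f * f' <= (L / 2) * (L' / 2).
    by rewrite -mulrNN ler_pM ?oppr_ge0//; lra.
  lra.
have h0 : f' * t <= - f * t' by lra.
have h1 : t ^+ 2 * L' ^+ 2 <= t' ^+ 2 * L ^+ 2.
  have : (f' * t) ^+ 2 <= (- f * t') ^+ 2.
    rewrite ler_pXn2r// nnegrE; first by rewrite mulr_ge0 ?ltW.
    by rewrite mulr_ge0 ?oppr_ge0 ?ltW.
  rewrite -e -e' !exprMn sqrrN; lra.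
have h2 : L * L' * (3 / 4) <= t * t'.
  apply: ler_mul_sqr; [exact: ltW|exact: ltW|].
  have h3 : 3 / 4 * L ^+ 2 * L' ^+ 2 <= t ^+ 2 * L' ^+ 2.
    by rewrite ler_wpM2r ?sqr_ge0.
  have h4 : 3 / 4 * (L ^+ 2 * t' ^+ 2) <= t ^+ 2 * t' ^+ 2.
    by rewrite mulrA ler_wpM2r ?sqr_ge0.
  lra.
have : f * f' <= 0 by rewrite nmulr_rle0 // ltW.
have := mulr_ge0 L0 L'0.
lra.
Qed.

(* For z = f + i t and z' = f' + i t' of argument in ]0, 120] degrees: if
   Re (z z') > - |z z'| / 2 then arg z + arg z' < 120, hence Im (z z') > 0. *)
Lemma arg_add (R : realFieldType) (f t L f' t' L' : R) :
  f ^+ 2 + t ^+ 2 = L ^+ 2 -> f' ^+ 2 + t' ^+ 2 = L' ^+ 2 ->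
  0 <= L -> 0 <= L' -> 0 < t -> 0 < t' ->
  - (L / 2) <= f -> - (L' / 2) <= f' -> - (L * L' / 2) < f * f' - t * t' ->
  0 < f * t' + f' * t.
Proof.
move=> e e' L0 L'0 t0 t'0 fL f'L' re.
have [//|im] := ltP 0 (f * t' + f' * t).
have [f0|f0] := ltP f 0.
  by have := arg_add_neg e e' L0 L'0 t0 t'0 fL f0 f'L' im; rewrite leNgt re.
have [f'0|f'0] := ltP f' 0.
  have := arg_add_neg e' e L'0 L0 t'0 t0 f'L' f'0 fL.
  rewrite addrC => /(_ im).
  by rewrite [f' * _]mulrC [t' * _]mulrC [L' * _]mulrC leNgt re.
(* Neither angle is obtuse, so [im] leaves two right angles, whose sum has cosine -1, against
   [re]. *)
have f00 : f = 0 by nra.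
have f'00 : f' = 0 by nra.
have tL : L = t.
  by move/esym/eqP: e; rewrite f00 expr0n add0r eqrXn2 ?(ltW t0)// => /eqP.
have tL' : L' = t'.
  by move/esym/eqP: e'; rewrite f'00 expr0n add0r eqrXn2 ?(ltW t'0)// => /eqP.
move: re; rewrite f00 f'00 tL tL'; have := mulr_gt0 t0 t'0; lra.
Qed.

(** Add cos(difference) <= 1 and cos(sum) <= -1/2 with weights [(1 - 2 * k) / 3] and
    [2 * (1 + k) / 3]. Two angles of 60 degrees give equality, whence the constant. *)
Lemma cos_cos_le (R : realFieldType) (k f t L f' t' L' : R) :
  f ^+ 2 + t ^+ 2 = L ^+ 2 -> f' ^+ 2 + t' ^+ 2 = L' ^+ 2 ->
  0 <= L -> 0 <= L' -> 0 <= k -> k <= 1 / 2 ->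
  f * f' - t * t' <= - (L * L' / 2) ->
  f * f' + k * (L * L') <= (4 * k + 1) / 3 * (t * t').
Proof.
move=> e e' L0 L'0 k0 k2 re.
have cs : f * f' + t * t' <= L * L'.
  apply: ler_mul_sqr => //; rewrite -e -e'.
  by have := sqr_ge0 (f * t' - f' * t); lra.
have k0' : 0 <= 1 - 2 * k by lra.
have k1 : 0 <= 1 + k by lra.
have := ler_wpM2l k0' cs; have := ler_wpM2l k1 re.
lra.
Qed.

(** * Pairs of Euclidean triangles with a common side *)

(* By the law of cosines: in the Euclidean triangle with sides x, y, z, the
   angle opposite to z has cosine at least -k. *)
Definition angle_le (R : realFieldType) (k x y z : R) :=
  z ^+ 2 <= x ^+ 2 + y ^+ 2 + 2 * k * (x * y).

Definition angles_le (R : realFieldType) (k x y z : R) :=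
  [/\ 0 < x, 0 < y & 0 < z] /\
  [/\ angle_le k x y z, angle_le k x z y & angle_le k y z x].

(* x y cos(angle between x and y) in the Euclidean triangle with sides x, y, z. *)
Definition side_dot (R : realFieldType) (x y z : R) :=
  (x ^+ 2 + y ^+ 2 - z ^+ 2) / 2.

(** Heron's formula for the square of twice the area; its factors are positive because [k < 1] makes
    the triangle inequalities strict. *)
Lemma area_gt0 (R : realFieldType) (k w a b : R) :
  k <= 1 / 2 -> angles_le k w a b ->
  0 < (w * a) ^+ 2 - side_dot w a b ^+ 2.
Proof.
move=> k2 [[w0 a0 b0] [hb ha hw]]; rewrite /side_dot.
have -> : (w * a) ^+ 2 - ((w ^+ 2 + a ^+ 2 - b ^+ 2) / 2) ^+ 2 =
  (w + a + b) * (w + a - b) * (w + b - a) * (a + b - w) / 4 by field.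
have h (x y z : R) : 0 < x -> 0 < y -> 0 < z -> angle_le k x y z -> 0 < x + y - z.
  move=> x0 y0 z0 hz; rewrite subr_gt0 -(@ltr_pXn2r _ 2) ?nnegrE ?ltW ?addr_gt0//.
  apply: le_lt_trans hz _; rewrite sqrrD.
  have := mulr_gt0 x0 y0; nra.
have wab : 0 < w + a + b by rewrite !addr_gt0.
by rewrite divr_gt0// !mulr_gt0//; apply: h.
Qed.

(* Otherwise the angle sums at all three vertices would be less than 120
   degrees, although they add up to 360. *)
Lemma exists_wide_vertex (R : realFieldType) (k w a b t a' b' t' : R) :
  let f := side_dot w a b in let f' := side_dot w a' b' in
  let g := side_dot w b a in let g' := side_dot w b' a' in
  let h := side_dot a b w in let h' := side_dot a' b' w in
  k <= 1 / 2 -> angles_le k w a b -> angles_le k w a' b' ->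
  0 < t -> 0 < t' ->
  f ^+ 2 + t ^+ 2 = (w * a) ^+ 2 -> f' ^+ 2 + t' ^+ 2 = (w * a') ^+ 2 ->
  [\/ f * f' - t * t' <= - (w * a * (w * a') / 2),
      g * g' - t * t' <= - (w * b * (w * b') / 2) |
      h * h' - t * t' <= - (a * b * (a' * b') / 2)].
Proof.
move=> f f' g g' h h' k2 [[w0 a0 b0] [lb la lw]] [[_ a'0 b'0] [lb' la' lw']].
move=> t0 t'0 ft ft'.
(* Twice the area is the same number [t] seen from each vertex. *)
have gt : g ^+ 2 + t ^+ 2 = (w * b) ^+ 2 by move: ft; rewrite /f /g /side_dot; nra.
have gt' : g' ^+ 2 + t' ^+ 2 = (w * b') ^+ 2 by move: ft'; rewrite /f' /g' /side_dot; nra.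
have ht : h ^+ 2 + t ^+ 2 = (a * b) ^+ 2 by move: ft; rewrite /f /h /side_dot; nra.
have ht' : h' ^+ 2 + t' ^+ 2 = (a' * b') ^+ 2 by move: ft'; rewrite /f' /h' /side_dot; nra.
have lo x y z : 0 < x -> 0 < y -> angle_le k x y z -> - (x * y / 2) <= side_dot x y z.
  move=> x0 y0; rewrite /angle_le /side_dot; have := ler_wpM2r (ltW (mulr_gt0 x0 y0)) k2; lra.
have [|hf] := leP (f * f' - t * t') (- (w * a * (w * a') / 2)); first by constructor.
have [|hg] := leP (g * g' - t * t') (- (w * b * (w * b') / 2)); first by constructor.
have [|hh] := leP (h * h' - t * t') (- (a * b * (a' * b') / 2)); first by constructor.
have wa := mulr_gt0 w0 a0; have wb := mulr_gt0 w0 b0; have ab := mulr_gt0 a0 b0.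
have wa' := mulr_gt0 w0 a'0; have wb' := mulr_gt0 w0 b'0; have ab' := mulr_gt0 a'0 b'0.
have if0 := arg_add ft ft' (ltW wa) (ltW wa')
  t0 t'0 (lo _ _ _ w0 a0 lb) (lo _ _ _ w0 a'0 lb') hf.
have ig0 := arg_add gt gt' (ltW wb) (ltW wb')
  t0 t'0 (lo _ _ _ w0 b0 la) (lo _ _ _ w0 b'0 la') hg.
have ih0 := arg_add ht ht' (ltW ab) (ltW ab')
  t0 t'0 (lo _ _ _ a0 b0 lw) (lo _ _ _ a'0 b'0 lw') hh.
have fg : f * g - t ^+ 2 = - w ^+ 2 * h by move: ft; rewrite /f /g /h /side_dot; nra.
have fg' : f' * g' - t' ^+ 2 = - w ^+ 2 * h' by move: ft'; rewrite /f' /g' /h' /side_dot; nra.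
have fgD : f + g = w ^+ 2 by rewrite /f /g /side_dot; field.
have fgD' : f' + g' = w ^+ 2 by rewrite /f' /g' /side_dot; field.
(* (f + i t) (g + i t) = w^2 (- h + i t): the angles add up to 180 degrees. *)
have re : (f * f' - t * t') * (g * g' - t * t') - (f * t' + f' * t) * (g * t' + g' * t) =
   w ^+ 4 * (h * h' - t * t').
  transitivity ((f * g - t ^+ 2) * (f' * g' - t' ^+ 2) - t * t' * (f + g) * (f' + g')).
    by ring.
  by rewrite fg fg' fgD fgD'; ring.
have im : (f * f' - t * t') * (g * t' + g' * t) + (g * g' - t * t') * (f * t' + f' * t) =
   - (w ^+ 4 * (h * t' + h' * t)).
  transitivity ((f * g - t ^+ 2) * (t' * (f' + g')) + (f' * g' - t' ^+ 2) * (t * (f + g))).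
    by ring.
  by rewrite fg fg' fgD fgD'; ring.
have nU : (f * f' - t * t') ^+ 2 + (f * t' + f' * t) ^+ 2 = (w * a * (w * a')) ^+ 2.
  by rewrite [RHS]exprMn -ft -ft'; ring.
have nV : (g * g' - t * t') ^+ 2 + (g * t' + g' * t) ^+ 2 = (w * b * (w * b')) ^+ 2.
  by rewrite [RHS]exprMn -gt -gt'; ring.
have w4 : 0 < w ^+ 4 by rewrite exprn_gt0.
(* The products at the first two vertices satisfy the hypotheses of [arg_add] again. It would make
   the imaginary part of their product positive, but [im] and [ih0] make it negative. *)
have := arg_add nU nV (ltW (mulr_gt0 wa wa')) (ltW (mulr_gt0 wb wb')) if0 ig0 (ltW hf) (ltW hg).
rewrite re im => H.
suff : 0 < - (w ^+ 4 * (h * t' + h' * t)) by rewrite oppr_gt0 ltNge ltW// mulr_gt0.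
apply: H.
have -> : - (w * a * (w * a') * (w * b * (w * b')) / 2) = w ^+ 4 * (- (a * b * (a' * b') / 2)) by field.
by rewrite ltr_pM2l.
Qed.

Lemma pair_bound (R : realFieldType) (k w a b t a' b' t' D : R) :
  let f := side_dot w a b in let f' := side_dot w a' b' in
  0 <= k -> k <= 1 / 2 -> angles_le k w a b -> angles_le k w a' b' ->
  0 < t -> 0 < t' ->
  f ^+ 2 + t ^+ 2 = (w * a) ^+ 2 -> f' ^+ 2 + t' ^+ 2 = (w * a') ^+ 2 ->
  angle_le k a a' D -> angle_le k b b' D -> angle_le k (a * b') (a' * b) (w * D) ->
  (w * D) ^+ 2 <= w ^+ 2 * (a ^+ 2 + a' ^+ 2) - 2 * (f * f') + 2 * ((4 * k + 1) / 3) * (t * t').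
Proof.
move=> f f' k0 k2 T T' t0 t'0 ft ft' da db dw.
pose g := side_dot w b a; pose g' := side_dot w b' a'.
pose h := side_dot a b w; pose h' := side_dot a' b' w.
have := T; case=> [[w0 a0 b0] _]; have := T'; case=> [[_ a'0 b'0] _].
have gt : g ^+ 2 + t ^+ 2 = (w * b) ^+ 2 by move: ft; rewrite /f /g /side_dot; nra.
have gt' : g' ^+ 2 + t' ^+ 2 = (w * b') ^+ 2 by move: ft'; rewrite /f' /g' /side_dot; nra.
have ht : h ^+ 2 + t ^+ 2 = (a * b) ^+ 2 by move: ft; rewrite /f /h /side_dot; nra.
have ht' : h' ^+ 2 + t' ^+ 2 = (a' * b') ^+ 2 by move: ft'; rewrite /f' /h' /side_dot; nra.
have w2 : 0 <= w ^+ 2 by rewrite sqr_ge0.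
have ge0 (x y : R) : 0 < x -> 0 < y -> 0 <= x * y by move=> ? ?; rewrite mulr_ge0 ?ltW.
rewrite /angle_le in da db dw.
case: (exists_wide_vertex k2 T T' t0 t'0 ft ft') => v.
- have := cos_cos_le ft ft' (ge0 _ _ w0 a0) (ge0 _ _ w0 a'0) k0 k2 v.
  by have := ler_wpM2l w2 da; rewrite exprMn; lra.
- have := cos_cos_le gt gt' (ge0 _ _ w0 b0) (ge0 _ _ w0 b'0) k0 k2 v.
  have := ler_wpM2l w2 db; rewrite exprMn.
  (* The polarized Heron form has the same value written at any vertex; here and in the last case it
     is moved to the wide one. *)
  have -> : w ^+ 2 * (a ^+ 2 + a' ^+ 2) - 2 * (f * f') = w ^+ 2 * (b ^+ 2 + b' ^+ 2) - 2 * (g * g').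
    by rewrite /f /f' /g /g' /side_dot; field.
  lra.
- have := cos_cos_le ht ht' (ge0 _ _ a0 b0) (ge0 _ _ a'0 b'0) k0 k2 v.
  have -> : w ^+ 2 * (a ^+ 2 + a' ^+ 2) - 2 * (f * f') = (a * b') ^+ 2 + (a' * b) ^+ 2 - 2 * (h * h').
    by rewrite /f /f' /h /h' /side_dot; field.
  lra.
Qed.

(** * The power inequality *)

Lemma powR_le_tangent (R : realType) (x p : R) :
  0 <= x -> 0 <= p <= 1 -> x `^ p <= 1 + p * (x - 1).
Proof.
move=> x0 /andP[]; rewrite le_eqVlt => /predU1P[<- _|p0].
  by rewrite powRr0 mul0r addr0.
rewrite le_eqVlt => /predU1P[->|p1]; first by rewrite powRr1// mul1r addrC subrK.
have p1' : 0 < 1 - p by rewrite subr_gt0.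
(* Young's inequality with second factor 1 and conjugate exponents [p^-1] and [(1 - p)^-1]. *)
have := @conjugate_powR R (x `^ p) 1 p^-1 (1 - p)^-1.
rewrite powR_ge0 ler01 !invr_gt0 p0 p1' !invrK [p + _]addrC subrK.
move=> /(_ isT isT isT isT erefl).
rewrite mulr1 -powRrM mulfV ?gt_eqF// powRr1// powR1; lra.
Qed.

(** The weights [t] and [1 - t] average the points [t] and [1 + t] to 1, so concavity of the power
    [q - 1] suffices. *)
Lemma powR_convex_comb_le1 (R : realType) (t q : R) : 0 <= t <= 1 -> 1 <= q <= 2 ->
  t * t `^ (q - 1) + (1 - t) * (1 + t) `^ (q - 1) <= 1.
Proof.
move=> /andP[t0 t1] /andP[q1 q2].
have q01 : 0 <= q - 1 <= 1 by lra.
have h1 : t `^ (q - 1) <= 1 + (q - 1) * (t - 1) by exact: powR_le_tangent.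
have h2 : (1 + t) `^ (q - 1) <= 1 + (q - 1) * (1 + t - 1).
  by apply: powR_le_tangent => //; rewrite addr_ge0.
have t1' : 0 <= 1 - t by rewrite subr_ge0.
have := ler_wpM2l t0 h1; have := ler_wpM2l t1' h2; lra.
Qed.

Lemma powR_pred (R : realType) (x q : R) : 0 < x -> x `^ q = x * x `^ (q - 1).
Proof.
move=> x0; rewrite -[X in _ = X * _](powRr1 (ltW x0)) -powRD ?(gt_eqF x0) ?implybT//.
by congr (_ `^ _); ring.
Qed.

(** The quotient [F] of the excess by the power [q / 2] is nondecreasing up to 1, by
    [powR_convex_comb_le1], and [F 1] is the constant in the bound. *)
Lemma powR_add_le01 (R : realType) (t q : R) : 0 < t <= 1 -> 1 <= q <= 2 ->
  (1 + t) `^ q <= 1 + t `^ q + (2 `^ q - 2) * t `^ (q / 2).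
Proof.
move=> /andP[t0 t1] q12.
pose F (s : R) := ((1 + s) `^ q - 1 - s `^ q) * s `^ (- (q / 2)).
pose dF (s : R) := (q * (1 + s) `^ (q - 1) - q * s `^ (q - 1)) * s `^ (- (q / 2))
  + ((1 + s) `^ q - 1 - s `^ q) * (- (q / 2) * s `^ (- (q / 2) - 1)).
have derF (s : R) : 0 < s -> is_derive s 1 F (dF s).
  move=> s0.
  have s1 : 0 < 1 + s by rewrite addr_gt0.
  have d1 : is_derive s 1 (fun s : R => (1 + s) `^ q) (q * (1 + s) `^ (q - 1)).
    have := @is_derive1_comp R (fun s => s `^ q) (fun s => 1 + s) s
       (q * (1 + s) `^ (q - 1)) 1 (is_derive1_powR _ s1).
    rewrite mulr1; apply.
    have := is_derive_shift s 1 1; rewrite (_ : shift 1 = fun s => 1 + s)//.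
    by apply/funext => y; rewrite /= addrC.
  have d2 := is_derive1_powR q s0.
  have d3 := is_derive1_powR (- (q / 2)) s0.
  apply: is_derive_eq.
  rewrite /dF /GRing.scale /=; ring.
have dF0 (s : R) : 0 < s -> s <= 1 -> 0 <= dF s.
  move=> s0 s1.
  have := @powR_convex_comb_le1 _ s q; rewrite (ltW s0) s1 => /(_ isT q12) h.
  rewrite /dF [(1 + s) `^ q]powR_pred ?addr_gt0// [s `^ q]powR_pred//.
  rewrite [s `^ (- (q / 2))]powR_pred//.
  set u := (1 + s) `^ _ in h *; set v := s `^ (q - 1) in h *.
  have : 0 <= s `^ (- (q / 2) - 1) by exact: powR_ge0.
  set e := s `^ _ => e0.
  have -> : (q * u - q * v) * (s * e) + ((1 + s) * u - 1 - s * v) * (- (q / 2) * e) =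
    q / 2 * e * (1 - (s * v + (1 - s) * u)) by field.
  by rewrite !mulr_ge0// ?subr_ge0//; lra.
have F1 : F t <= F 1.
  apply: (@ger0_derive1_le_cc _ F t 1) => //; rewrite ?in_itv/= ?lexx ?t1//.
  - move=> s; rewrite in_itv/= => /andP[ts _].
    by have := derF s (lt_trans t0 ts) => -[].
  - move=> s; rewrite in_itv/= => /andP[ts s1].
    have s0 := lt_trans t0 ts.
    by rewrite derive1E (@derive_val _ _ _ _ _ _ _ (derF s s0)) dF0// ltW.
  - apply: derivable_within_continuous => s; rewrite in_itv/= => /andP[ts _].
    by have := derF s (lt_le_trans t0 ts) => -[].
have tq : 0 < t `^ (q / 2) by rewrite powR_gt0.
move: F1; rewrite /F !powR1 mulr1 powRN ler_pdivrMr// -[1 + 1]/(2 : R).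
lra.
Qed.

Lemma powR_add_le (R : realType) (a b q : R) : 0 <= a -> 0 <= b -> 1 <= q <= 2 ->
  (a + b) `^ q <= a `^ q + b `^ q + (2 `^ q - 2) * (a `^ (q / 2) * b `^ (q / 2)).
Proof.
move=> a0 b0 q12.
have q0 : q != 0 by apply/eqP => q0; move: q12; rewrite q0; lra.
have q20 : q / 2 != 0 by rewrite mulf_neq0.
wlog ab : a b a0 b0 / a <= b.
  move=> H; have [/H|/ltW/H] := leP a b; first exact.
  by rewrite [b + a]addrC [b `^ q + _]addrC [b `^ _ * _]mulrC; apply.
move: a0; rewrite le_eqVlt => /predU1P[<-|a0].
  by rewrite !powR0// !add0r mul0r mulr0 addr0.
have b0' := lt_le_trans a0 ab.
have t01 : 0 < a / b <= 1 by rewrite divr_gt0//= ler_pdivrMr// mul1r.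
have t0 : 0 <= a / b by case/andP: t01 => /ltW.
have bq : 0 <= b `^ q by exact: powR_ge0.
have eb : b `^ q = b `^ (q / 2) * b `^ (q / 2).
  by rewrite -powRD ?(gt_eqF b0') ?implybT// -splitr.
have ea p : a `^ p = (a / b) `^ p * b `^ p by rewrite -powRM// divfK// gt_eqF.
have -> : a + b = (1 + a / b) * b by field; rewrite gt_eqF.
rewrite !ea powRM ?addr_ge0//.
have -> : (a / b) `^ (q / 2) * b `^ (q / 2) * b `^ (q / 2) = (a / b) `^ (q / 2) * b `^ q.
  by rewrite eb mulrA.
have := ler_wpM2r bq (powR_add_le01 t01 q12).
lra.
Qed.

(** * Summation over the negative points *)

Lemma sqr_sum_le (R : realFieldType) (I : Type) (s : seq I) (n : I -> R) :
  (\sum_(i <- s) n i) ^+ 2 <= (size s)%:R * \sum_(i <- s) n i ^+ 2.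
Proof.
elim: s => [|x s IH]; first by rewrite !big_nil expr0n mulr0.
rewrite !big_cons /= -natr1.
set S := \sum_(i <- s) n i in IH *; set Q := \sum_(i <- s) n i ^+ 2 in IH *.
suff : 2 * (n x * S) <= (size s)%:R * n x ^+ 2 + Q by nra.
have : 0 <= \sum_(i <- s) (n x - n i) ^+ 2 by apply: sumr_ge0 => i _; exact: sqr_ge0.
under eq_bigr do rewrite sqrrB.
rewrite big_split sumrB /= -/Q big_const_seq count_predT iter_addr addr0 -mulr_natl.
under [X in _ - X]eq_bigr do rewrite -mulr_natl mulrA.
rewrite -mulr_sumr -/S; lra.
Qed.

(** [W], [A], [B], [D] are squared delta-distances and [- m i] the negative coefficients. [W] times
    the left side is at most [- 2 * (p2 * W - F) ^+ 2 + 2 * (K * T ^+ 2 - (1 + K) * Q)]. *)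
Lemma two_pos_form_le (R : realFieldType) (I : eqType) (s : seq I)
    (W p1 p2 K : R) (m A B t : I -> R) (D : I -> I -> R) :
  let f i := (W + A i - B i) / 2 in
  uniq s -> 0 < W -> 0 <= K -> K * ((size s)%:R - 1) <= 1 ->
  p1 + p2 = \sum_(i <- s) m i ->
  {in s, forall i, 0 <= m i} ->
  {in s, forall i, D i i = 0} ->
  {in s, forall i, f i ^+ 2 + t i ^+ 2 = W * A i} ->
  {in s &, forall i j, i != j ->
     W * D i j <= W * (A i + A j) - 2 * (f i * f j) + 2 * K * (t i * t j)} ->
  2 * (p1 * p2 * W) - 2 * \sum_(i <- s) m i * (p1 * A i + p2 * B i)
    + \sum_(i <- s) \sum_(j <- s) m i * m j * D i j <= 0.
Proof.
move=> f us W0 K0 Ks sm m0 Dii ft hD.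
set S := \sum_(i <- s) m i in sm.
pose u := \sum_(i <- s) m i * A i; pose v := \sum_(i <- s) m i * B i.
pose F := \sum_(i <- s) m i * f i; pose T := \sum_(i <- s) m i * t i.
pose Q := \sum_(i <- s) (m i * t i) ^+ 2.
have FE : F = (W * S + u - v) / 2.
  rewrite /F /f /S /u /v mulr_sumr -big_split /= -sumrB mulr_suml.
  by apply: eq_bigr => i _; field.
have E1 : \sum_(i <- s) m i * (p1 * A i + p2 * B i) = p1 * u + p2 * v.
  by rewrite /u /v !mulr_sumr -big_split /=; apply: eq_bigr => i _; ring.
(* On the diagonal the pair bound would give [2 * (1 + K) * t i ^+ 2] instead of 0; the last term
   removes it. *)
pose E i j := W * (A i + A j) - 2 * (f i * f j) + 2 * K * (t i * t j)
  - (i == j)%:R * (2 * (1 + K) * t i ^+ 2).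
have hE : {in s &, forall i j, W * D i j <= E i j}.
  move=> i j si sj; rewrite /E; case: eqVneq => [<-|ij].
    by rewrite Dii// mul1r mulr0; have := ft _ si; lra.
  by rewrite mul0r subr0; exact: hD.
have inner i : i \in s -> \sum_(j <- s) m i * m j * E i j =
    W * (m i * A i) * S + W * m i * u - 2 * (m i * f i) * F
    + 2 * K * (m i * t i) * T - 2 * (1 + K) * (m i * t i) ^+ 2.
  move=> si.
  have -> : (m i * t i) ^+ 2 = \sum_(j <- s) (i == j)%:R * (m i * m j * t i ^+ 2).
    rewrite (bigD1_seq i)//= eqxx mul1r big1_seq ?addr0; first by ring.
    by move=> j /andP[/negPf ji _]; rewrite eq_sym ji mul0r.
  rewrite /S /u /F /T !mulr_sumr -!big_split /= -!sumrN -!big_split /=.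
  by apply: eq_bigr => j _; rewrite /E; ring.
have tot : \sum_(i <- s) \sum_(j <- s) m i * m j * E i j =
    2 * W * u * S - 2 * F ^+ 2 + 2 * K * T ^+ 2 - 2 * (1 + K) * Q.
  rewrite (eq_big_seq _ inner) !big_split /= !sumrN.
  rewrite -!mulr_suml -!mulr_sumr -/u -/S -/F -/T -/Q; ring.
have le : W * (\sum_(i <- s) \sum_(j <- s) m i * m j * D i j) <=
    \sum_(i <- s) \sum_(j <- s) m i * m j * E i j.
  rewrite mulr_sumr big_seq [leRHS]big_seq; apply: ler_sum => i si.
  rewrite mulr_sumr big_seq [leRHS]big_seq; apply: ler_sum => j sj.
  by rewrite mulrCA ler_wpM2l ?mulr_ge0 ?m0// hE.
(* Cauchy-Schwarz costs a factor [size s], and [Ks] says that [K * size s <= 1 + K]. *)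
have TQ : K * T ^+ 2 <= (1 + K) * Q.
  have Q0 : 0 <= Q by apply: sumr_ge0 => i _; exact: sqr_ge0.
  have := ler_wpM2l K0 (sqr_sum_le s (fun i => m i * t i)); rewrite -/T -/Q => h.
  apply: le_trans h _; rewrite mulrA ler_wpM2r//; lra.
rewrite -(pmulr_rle0 _ W0) E1 mulrDr mulrBr.
rewrite tot in le.
have p2E : p1 = S - p2 by rewrite -sm addrK.
have sq := sqr_ge0 (p2 * W - F).
have id : W * (2 * (p1 * p2 * W)) - W * (2 * (p1 * u + p2 * v)) + (2 * W * u * S - 2 * F ^+ 2)
   = - (2 * (p2 * W - F) ^+ 2) by rewrite FE p2E; field.
lra.
Qed.

(** * Constants, support and application to the metric *)

(** The bound on [q] says that 2 to the power [q] is at most 3, which is exactly the 120-degree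
    condition [k <= 1 / 2]. *)
Lemma kappa_bounds (R : realType) (q : R) : 1 <= q -> q <= log2 3 ->
  q <= 2 /\ 0 <= 2 `^ (q - 1) - 1 <= 1 / 2.
Proof.
move=> q1 q2.
have l2 : 0 < ln 2 :> R by rewrite ln_gt0// ltr1n.
have h3 : 2 `^ q <= 3 :> R.
  rewrite -(@lnK _ 3) ?posrE// /powR gt_eqF// ler_expR.
  by move: q2; rewrite /log2 ler_pdivlMr.
have e : 2 `^ q = 2 * 2 `^ (q - 1) :> R by exact: powR_pred.
have h1 : 1 <= 2 `^ (q - 1) :> R.
  by rewrite -[leLHS](powRr0 2) ler_powR ?ler1n// subr_ge0.
split; last by lra.
apply: (le_trans q2); rewrite /log2 ler_pdivrMr//.
by rewrite mulr_natl -lnXn// ler_ln ?posrE ?exprn_gt0//; lra.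
Qed.

Lemma kappaE (R : realType) (q : R) : kappa q = (4 * (2 `^ (q - 1) - 1) + 1) / 3.
Proof.
rewrite /kappa powR_pred ?ltr0n// addrK [2 `^ q]powR_pred ?ltr0n//.
by field.
Qed.

Lemma sum2_cons2 (R : realType) (X : choiceType) (s : seq X) (x y : X) (G : X -> X -> R) :
  (forall a b, G a b = G b a) -> G x x = 0 -> G y y = 0 ->
  \sum_(a <- [:: x, y & s]) \sum_(b <- [:: x, y & s]) G a b =
  2 * G x y + 2 * \sum_(a <- s) (G x a + G y a) + \sum_(a <- s) \sum_(b <- s) G a b.
Proof.
move=> sG xx yy.
under eq_bigr do rewrite !big_cons.
rewrite !big_cons !big_split /= xx yy (sG y x).
rewrite [\sum_(i <- s) G i x](eq_bigr (G x)); last by move=> i _; rewrite sG.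
rewrite [\sum_(i <- s) G i y](eq_bigr (G y)); last by move=> i _; rewrite sG.
ring.
Qed.

Lemma powR_half_sqr (R : realType) (x q : R) : q != 0 -> (x `^ (q / 2)) ^+ 2 = x `^ q.
Proof.
move=> q0; rewrite expr2 -powRD -?splitr//; apply/implyP => /eqP qq0.
by rewrite qq0 eqxx in q0.
Qed.

(** Stated for real numbers so that it applies to distances and, for Ptolemy, to products of
    distances. *)
Lemma angle_le_powR (R : realType) (q x y z : R) :
  1 <= q <= 2 -> 0 <= x -> 0 <= y -> 0 <= z -> z <= x + y ->
  angle_le (2 `^ (q - 1) - 1) (x `^ (q / 2)) (y `^ (q / 2)) (z `^ (q / 2)).
Proof.
move=> q12 x0 y0 z0 zxy.
have q0 : 0 < q by lra.
rewrite /angle_le !powR_half_sqr ?gt_eqF//.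
have -> : 2 * (2 `^ (q - 1) - 1) = 2 `^ q - 2 :> R.
  by rewrite (@powR_pred _ 2 q) ?ltr0n//; ring.
apply: le_trans (powR_add_le x0 y0 q12).
by rewrite ge0_ler_powR ?nnegrE ?addr_ge0 ?(ltW q0).
Qed.

Lemma cardfs_eq2_perm (K : choiceType) (A : {fset K}) : #|` A| = 2%N ->
  exists x y, x != y /\ perm_eq (enum_fset A) [:: x; y].
Proof.
rewrite /=; have := fset_uniq A.
case: (enum_fset A) => [|x [|y [|? ?]]] //= /andP[]; rewrite inE => xy _ _.
by exists x, y; split.
Qed.

Lemma finsupp_perm (R : realType) (X : choiceType) (c : {fsfun X -> R with 0}) :
  perm_eq (finsupp c) (enum_fset (pos_supp c) ++ enum_fset (neg_supp c)).
Proof.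
have inP x : (x \in pos_supp c) = (0 < c x).
  rewrite !inE /= mem_finsupp; case: (ltP 0 (c x)) => [/gt_eqF->//|]; by rewrite andbF.
have inN x : (x \in neg_supp c) = (c x < 0).
  rewrite !inE /= mem_finsupp; case: (ltP (c x) 0) => [/lt_eqF->//|]; by rewrite andbF.
apply: uniq_perm; first exact: fset_uniq.
  rewrite cat_uniq !fset_uniq andbT /= -all_predC; apply/allP => x /=.
  by rewrite inN inP => /ltW; rewrite leNgt.
by move=> x; rewrite mem_cat inP inN mem_finsupp neq_lt orbC.
Qed.

Theorem theorem5p2 (R : realType) (X : metricType R)
  (hX : ptolemaic X)
  (c : {fsfun X -> R with 0}) (hc : zero_sum c)
  (hpos : #|` pos_supp c| = 2%N)
  (r : nat) (hr : (2 <= r)%N) (hneg : #|` neg_supp c| = r)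
  (q : R) (hq1 : 1 <= q) (hq2 : q <= log2 3)
  (hkappa : kappa q <= 1 / (r%:R - 1)) :
  negative_type_ineq q c.
Proof.
have [q2 /andP[]] := kappa_bounds hq1 hq2.
set k := 2 `^ (q - 1) - 1 => k0 k2.
have q12 : 1 <= q <= 2 by rewrite hq1.
(* Since 0 to the power 0 is 1, the diagonal terms vanish only for a nonzero exponent. *)
have q0 : q != 0 by rewrite gt_eqF// (lt_le_trans ltr01).
have [x [y [xy pxy]]] := cardfs_eq2_perm hpos.
have ps : perm_eq (finsupp c) [:: x, y & enum_fset (neg_supp c)].
  by rewrite (permPl (finsupp_perm c)) -[[:: _, _ & _]]/([:: x; y] ++ _) perm_cat2r.
set s := enum_fset (neg_supp c) in ps *.
have := fset_uniq (finsupp c); rewrite (perm_uniq ps) /= inE negb_or.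
case/and3P => /andP[_ xs] ys us.
have negs z : z \in s -> c z < 0 by rewrite /s !inE => /andP[].
pose d (a b : X) := mdist a b `^ (q / 2).
have dd a b : d a b ^+ 2 = mdist a b `^ q by exact: powR_half_sqr.
have d_gt0 a b : a != b -> 0 < d a b by move=> ab; rewrite powR_gt0// mdist_gt0.
have d_tri a b e : angle_le k (d a b) (d b e) (d a e).
  by apply: angle_le_powR => //; rewrite ?mdist_ge0// metric_triangle.
have dC a b : d a b = d b a by rewrite /d metric_sym.
pose G a b := c a * c b * mdist a b `^ q.
have G0 a : G a a = 0 by rewrite /G mdistxx powR0 ?mulr0.
have GC a b : G a b = G b a by rewrite /G metric_sym; ring.
have neqs z : z \in s -> x != z /\ y != z.
  by move=> zs; split; [apply: contraNneq xs|apply: contraNneq ys] => ->.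
rewrite /negative_type_ineq (perm_big _ ps) /=.
under eq_bigr do rewrite (perm_big _ ps) /=.
rewrite (@sum2_cons2 _ _ s x y G)//.
move: hc; rewrite /zero_sum (perm_big _ ps) /= !big_cons => hc.
pose w := d x y; have w0 : 0 < w by exact: d_gt0.
have laww z : angle_le k (d x z) (d y z) w by rewrite (dC y z); exact: d_tri.
have lawy z : angle_le k w (d x z) (d y z) by rewrite /w (dC x y); exact: d_tri.
have lawx z : angle_le k w (d y z) (d x z) by exact: d_tri.
have tri z : z \in s -> angles_le k w (d x z) (d y z).
  by move=> /neqs[xz yz]; split; split; rewrite ?d_gt0.
pose A z := d x z ^+ 2; pose B z := d y z ^+ 2.
(* [Num.sqrt] is 0 on negative numbers; [area_gt0] excludes this case. *)
pose t z := Num.sqrt ((w * d x z) ^+ 2 - side_dot w (d x z) (d y z) ^+ 2).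
have t_gt0 z : z \in s -> 0 < t z.
  by move=> /tri; rewrite sqrtr_gt0; exact: area_gt0 k2.
have ft z : z \in s -> side_dot w (d x z) (d y z) ^+ 2 + t z ^+ 2 = (w * d x z) ^+ 2.
  by move=> /t_gt0; rewrite sqrtr_gt0 => h; rewrite sqr_sqrtr ?ltW//; ring.
have K0 : 0 <= kappa q by rewrite kappaE -/k; lra.
have Kr : kappa q * ((size s)%:R - 1) <= 1.
  rewrite -[size s]/(#|` neg_supp c|) hneg.
  by rewrite -ler_pdivlMr// subr_gt0 ltr1n.
(* Rewrite with the positive masses [- c z], to match [two_pos_form_le]. *)
have -> : 2 * G x y + 2 * (\sum_(z <- s) (G x z + G y z)) + \sum_(z <- s) \sum_(z' <- s) G z z' =
    2 * (c x * c y * w ^+ 2) - 2 * \sum_(z <- s) - c z * (c x * A z + c y * B z)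
    + \sum_(z <- s) \sum_(z' <- s) - c z * - c z' * d z z' ^+ 2.
  congr (2 * _ + _ + _); first by rewrite /G /w dd.
    rewrite -mulrN; congr (2 * _); rewrite -sumrN; apply: eq_bigr => z _.
    by rewrite /G /A /B !dd; ring.
  by apply: eq_bigr => z _; apply: eq_bigr => z' _; rewrite /G dd; ring.
apply: (@two_pos_form_le _ _ _ _ _ _ (kappa q) _ _ _ t) => //.
- by rewrite exprn_gt0.
- by rewrite sumrN; lra.
- by move=> z /negs z0; rewrite oppr_ge0 ltW.
- by move=> z _; rewrite dd mdistxx powR0.
- by move=> z /ft; rewrite [RHS]exprMn.
move=> z z' sz sz' zz'.
rewrite kappaE -/k -exprMn /A /B.
apply: pair_bound; rewrite ?t_gt0//; try exact: tri; try exact: ft.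
- by rewrite (dC x z); exact: d_tri.
- by rewrite (dC y z); exact: d_tri.
have ptol : mdist x y * mdist z z' <=
    mdist x z * mdist y z' + mdist x z' * mdist y z by exact: hX.
have := angle_le_powR q12 _ _ _ ptol; rewrite !powRM ?mdist_ge0//; apply;
  by rewrite mulr_ge0 ?mdist_ge0.
Qed.
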